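(* Let $H$ be a weakly norming graph. Then the normed space $(\mathcal{W}_{r(H)},\|\cdot\|_{r(H)})$ is neither uniformly smooth nor uniformly convex.
   Context: Graphs are finite and simple. Let $\Omega$ be a standard Borel space with an atomless probability measure $\nu$. For a graph $H$ on vertex set $\{v_1,\dots,v_n\}$ and a symmetric measurable $W:\Omega^2\to\mathbb{R}$, set $t(H,W):=\int_{\Omega^n}\prod_{\{v_i,v_j\}\in E(H)}W(x_i,x_j)\,d\nu^{\otimes n}(x_1,\dots,x_n)$. Let $\mathcal{W}_{r(H)}$ be the set of symmetric measurable $W:\Omega^2\to\mathbb{R}$ for which $t(H,|W|)$ is defined and finite, and $\|W\|_{r(H)}:=t(H,|W|)^{1/e(H)}$. $H$ is called weakly norming if $\|\cdot\|_{r(H)}$ is a norm on $\mathcal{W}_{r(H)}$. For a normed space $(X,\|\cdot\|)$, the modulus of convexity is $\mathfrak{d}_X(\varepsilon):=\inf\{1-\|\tfrac{x+y}{2}\| : x,y\in X,\ \|x-y\|\ge\varepsilon,\ \|x\|=\|y\|=1\}$ for $\varepsilon\in(0,2]$, and the modulus of smoothness is $\mathfrak{s}_X(\varepsilon):=\sup\{\tfrac12(\|x+y\|+\|x-y\|-2): x,y\in X,\ \|x\|=1,\ \|y\|=\varepsilon\}$ for $\varepsilon>0$. $X$ is uniformly convex if $\mathfrak{d}_X(\varepsilon)>0$ for every $\varepsilon>0$ and uniformly smooth if $\lim_{\varepsilon\searrow 0}\mathfrak{s}_X(\varepsilon)/\varepsilon=0$. *)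

(* Defs.v *)
From HB Require Import structures.
From mathcomp Require Import all_boot all_order all_algebra.
From mathcomp Require Import all_classical all_reals all_analysis.

Set Implicit Arguments.
Unset Strict Implicit.
Unset Printing Implicit Defensive.

Import Order.TTheory GRing.Theory Num.Theory.
Import numFieldNormedType.Exports.

Local Open Scope classical_set_scope.
Local Open Scope ring_scope.

(* Isomorphic, as a measurable space, to a Polish space with its Borel sets.
   Since [f] is bijective, every subset of [T] is of the form [f @^-1` A], so
   the last clause determines all the measurable sets of [T]. *)
Definition standard_borel (R : realType) d (T : measurableType d) : Prop :=
  exists (P : completePseudoMetricType R) (f : T -> P),
    [/\ hausdorff_space P,
        exists2 D : set P, countable D & dense D,
        bijective f &
        forall A : set P, <<s [set U : set P | open U] >> A <->
                          measurable (f @^-1` A)].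

Definition atomless (R : realType) d (T : measurableType d)
    (mu : set T -> \bar R) : Prop :=
  forall A, measurable A -> (0 < mu A)%E ->
    exists B, [/\ measurable B, B `<=` A, (0 < mu B)%E & (mu B < mu A)%E].

Section power_probability.
Context d (T : measurableType d) (R : realType).

Definition tuple_cons n (p : T * n.-tuple T) : n.+1.-tuple T :=
  [the n.+1.-tuple T of p.1 :: p.2].

Lemma measurable_tuple_cons n : measurable_fun [set: _] (@tuple_cons n).
Proof. exact: measurable_cons. Qed.

HB.instance Definition _ n :=
  isMeasurableFun.Build _ _ _ _ (@tuple_cons n) (@measurable_tuple_cons n).

(* The n-fold product measure of [nu]: the image of [nu \x nu^n] under
   [tuple_cons]; see [power_probabilityE] for its values on boxes. *)
Fixpoint power_probability (nu : probability T R) n :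
    probability (n.-tuple T) R :=
  match n with
  | 0 => \d_([tuple] : 0.-tuple T)
  | m.+1 => distribution (nu \x power_probability nu m)%E
              (@tuple_cons m : {mfun _ >-> _})
  end.

Lemma power_probabilityE (nu : probability T R) n (A : 'I_n -> set T) :
  (forall i, measurable (A i)) ->
  power_probability nu n [set x | forall i, A i (tnth x i)] =
  (\prod_(i < n) nu (A i))%E.
Proof.
elim: n A => [|n IHn] A mA /=.
  rewrite big_ord0 diracE mem_set//=; by case.
rewrite big_ord_recl -IHn//.
rewrite -[RHS]product_measure1E//; last first.
  have -> : [set x : n.-tuple T | forall i, A (lift ord0 i) (tnth x i)] =
      \bigcap_(i in [set: 'I_n]) ((@tnth n T ^~ i) @^-1` A (lift ord0 i)).
    by apply/seteqP; split=> [x Ax i _|x Ax i]; [exact: Ax|exact: (Ax i I)].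
  apply: fin_bigcap_measurable => // i _.
  by rewrite -[X in measurable X]setTI; exact: measurable_tnth.
rewrite /distribution/= /pushforward; congr (product_measure1 _ _ _).
apply/seteqP; split=> -[x s] /=.
  move=> Axs; split; first exact: (Axs ord0).
  by move=> i; have := Axs (lift ord0 i); rewrite tnthS.
move=> [Ax As] i; case: (unliftP ord0 i) => [j ->|->//].
by rewrite tnthS; exact: As.
Qed.

End power_probability.

Section normed_subspace.
Context (R : realType) (V : lmodType R).

(* A normed space of functions modulo null functions is handled through
   representatives: a subspace [X] of [V] with [N : V -> R] that is a norm on
   the quotient of [X] by the vectors in [null].  Such an [N] is constant on
   classes, by the triangle inequality. *)
Definition norm_modulo (null X : set V) (N : V -> R) : Prop :=
  [/\ [/\ X 0, forall x y, X x -> X y -> X (x + y)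
             & forall a x, X x -> X (a *: x)],
      forall x, X x -> N x = 0 <-> null x,
      forall a x, X x -> N (a *: x) = `|a| * N x &
      forall x y, X x -> X y -> N (x + y) <= N x + N y].

Definition modulus_of_convexity (X : set V) (N : V -> R) (eps : R) : \bar R :=
  ereal_inf [set z | exists x y,
    [/\ X x, X y, eps <= N (x - y), N x = 1 & N y = 1] /\
    z = (1 - N (2^-1 *: (x + y)))%:E].

Definition modulus_of_smoothness (X : set V) (N : V -> R) (eps : R) : \bar R :=
  ereal_sup [set z | exists x y,
    [/\ X x, X y, N x = 1 & N y = eps] /\
    z = (2^-1 * (N (x + y) + N (x - y) - 2))%:E].

Definition uniformly_convex (X : set V) (N : V -> R) : Prop :=
  forall eps : R, 0 < eps <= 2 -> (0 < modulus_of_convexity X N eps)%E.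

Definition uniformly_smooth (X : set V) (N : V -> R) : Prop :=
  (modulus_of_smoothness X N eps * (eps^-1)%:E)%E @[eps --> 0^'+] --> 0%E.

End normed_subspace.

Record sgraph (n : nat) := SGraph {
  adj : rel 'I_n ;
  adj_sym : symmetric adj ;
  adj_irr : irreflexive adj }.

(* Each edge {v_i, v_j} is represented by the pair (i, j) with i < j. *)
Definition edge n (H : sgraph n) : pred ('I_n * 'I_n) :=
  [pred p : 'I_n * 'I_n | (p.1 < p.2)%N && adj H p.1 p.2].

Section graph_norm.
Context (R : realType) d (T : measurableType d) (nu : probability T R).
Context (n : nat) (H : sgraph n).
Implicit Type W : T * T -> R.

Definition hom_density W : \bar R :=
  (\int[power_probability nu n]_x
     (\prod_(p | edge H p) W (tnth x p.1, tnth x p.2))%:E)%E.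

(* The integral of a nonnegative measurable function always exists in
   [0, +oo], so "defined and finite" is the finiteness of hom_density. *)
Definition graph_space : set (T * T -> R) :=
  [set W : T * T -> R | [/\ measurable_fun [set: T * T] W,
               forall x y, W (x, y) = W (y, x) &
               (hom_density (fun z => `|W z|%R) < +oo)%E]].

Definition graph_norm W : R :=
  fine (hom_density (fun z => `|W z|%R)) `^ (#|edge H|%:R)^-1.

(* For an edgeless graph the exponent is 0^-1 = 0 and graph_norm is constantly
   1, so such a graph is not weakly norming. *)
Definition weakly_norming : Prop :=
  norm_modulo [set W : T * T -> R | W = cst 0 %[ae (nu \x nu)%E]] graph_space graph_norm.

End graph_norm.

(* Main.v *)
(* Let [N] be the norm and [e] the number of edges of [H].  If [A] is a
   quasirandom symmetric subset of [Omega^2] of density 1/2, then [N \1_A] and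
   [N \1_(~` A)] are both close to 1/2, while [\1_A + \1_(~` A)] is the constant
   1, of norm 1.  After normalization [f] and [g] have norm 1, [f + g] has norm
   close to 2, and since [f] and [g] have disjoint supports,
   [|f - s g| = |f + s g|], so that [N (f - s g) = N (f + s g)], which is close
   to [1 + s].  This kills both uniform convexity ([s = 1]) and uniform
   smoothness ([s] tending to 0).

   The set [A] is obtained by averaging over all graphs on the cells of a
   partition of [Omega] into sets of small measure: tuples whose coordinates lie
   in distinct cells contribute exactly [2^-e].  The power mean inequality gives
   [N \1_A + N \1_(~` A) <= 1 + delta], and if [e >= 2], together with the triangle
   inequality [1 <= N \1_A + N \1_(~` A)], it keeps both norms away from 0.  For
   [e = 1] the norm is additive on nonnegative functions, and [A = B `*` B] with
   [0 < nu B < 1] will do. *)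

Require Import Defs.
From mathcomp Require Import all_boot all_order all_algebra.
From mathcomp Require Import all_classical all_reals all_analysis.
From mathcomp Require Import measurable_realfun ring lra.

Set Implicit Arguments.
Unset Strict Implicit.
Unset Printing Implicit Defensive.

Import Order.TTheory GRing.Theory Num.Theory.
Import numFieldNormedType.Exports.

Local Open Scope classical_set_scope.
Local Open Scope ring_scope.

(** * Partitions of an atomless probability space into cells of small measure *)

Section atomless_partition.
Context (R : realType) d (T : measurableType d) (nu : probability T R).

(** Repeated halving: when atomlessness splits [B] by some [C], either [C] or its complement in [B]
    has positive measure at most half that of [B]. *)
Lemma atomless_subset_lt (A : set T) (eta : R) :
  atomless nu -> measurable A -> (0 < nu A)%E -> 0 < eta ->
  exists B, [/\ measurable B, B `<=` A, (0 < nu B)%E & (nu B < eta%:E)%E].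
Proof.
move=> at_nu mA nuA eta0.
have halving k : exists B, [/\ measurable B, B `<=` A, (0 < nu B)%E &
    (nu B <= (2^-1 ^+ k)%:E)%E].
  elim: k => [|k [B [mB BA B0 Bk]]].
    by exists A; rewrite expr0; split => //; exact: probability_le1.
  have [C [mC CB C0 ltCB]] := at_nu _ mB B0.
  have mBC : measurable (B `\` C) by exact: measurableD.
  have BC : nu (B `\` C) = (nu B - nu C)%E.
    rewrite measureD// ?(setIidr CB)//.
    by rewrite ltey_eq fin_num_measure.
  move: C0 ltCB Bk BC.
  rewrite -(fineK (fin_num_measure nu _ mC)) -(fineK (fin_num_measure nu _ mB)).
  rewrite -(fineK (fin_num_measure nu _ mBC)).
  rewrite -EFinD !lte_fin lee_fin => C0 ltCB Bk [BC].
  have [le2|lt2] := leP (fine (nu C)) (fine (nu B) / 2).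
    exists C; split => //; first exact: subset_trans CB BA.
      by rewrite -(fineK (fin_num_measure nu _ mC)).
    rewrite -(fineK (fin_num_measure nu _ mC)) lee_fin exprSr; lra.
  exists (B `\` C); split => //; first by move=> x [/BA].
    by rewrite -(fineK (fin_num_measure nu _ mBC)) lte_fin; lra.
  rewrite -(fineK (fin_num_measure nu _ mBC)) lee_fin exprSr; lra.
have [k hk] : exists k, 2^-1 ^+ k < eta.
  have := @cvg_expr R 2^-1; rewrite ger0_norm ?invr_ge0//.
  rewrite invf_lt1// ltr1n => /(_ isT) /cvgr_lt /(_ _ eta0) [k _ /(_ k)] hk.
  by exists k; apply: hk => /=.
have [B [mB BA B0 Bk]] := halving k.
by exists B; split => //; rewrite (le_lt_trans Bk)// lte_fin.
Qed.

Let finely_covered (eta : R) (s : seq (set T)) : Prop :=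
  forall S, List.In S s -> measurable S /\ (nu S <= eta%:E)%E.

(** Cuts an overlapping cover into disjoint cells; the value [size s] marks the points that the
    cover misses. *)
Let first_index (s : seq (set T)) (x : T) : nat := find (fun S => x \in S) s.

Lemma bigsetU_first_index s :
  \big[setU/set0]_(S <- s) S = [set x | (first_index s x < size s)%N].
Proof.
elim: s => [|S s IH]; first by rewrite big_nil; apply/seteqP; split.
rewrite big_cons IH /first_index/=; apply/seteqP; split => x /=.
  by case: ifPn => // /negP; rewrite in_setE => nS [/nS|].
by case: ifPn => [/set_mem|] *; [left|right].
Qed.

(** Cell [k.+1] of [S :: s] is cell [k] of [s] with [S] removed, so induction on the list applies.
    The measure bound leaves out [k = size s], the uncovered remainder. *)
Lemma first_index_preimage eta s k : finely_covered eta s ->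
  measurable (first_index s @^-1` [set k]) /\
  ((k < size s)%N -> (nu (first_index s @^-1` [set k]) <= eta%:E)%E).
Proof.
elim: s k => [|S s IH] k sP.
  split => //; have [->|k0] := eqVneq k 0%N.
    by rewrite (_ : _ @^-1` _ = setT)//; apply/seteqP; split.
  rewrite (_ : _ @^-1` _ = set0)//; apply/seteqP; split => // x /= k0'.
  by rewrite -k0' in k0.
have [mS leS] : measurable S /\ (nu S <= eta%:E)%E by apply: sP; left.
case: k => [|k].
  have -> : first_index (S :: s) @^-1` [set 0%N] = S; last by [].
  apply/seteqP; split => x; rewrite /first_index/=; first by case: ifPn => [/set_mem|].
  by rewrite -in_setE => ->.
have [|mk lek] := IH k; first by move=> S' S's; apply: sP; right.
have E : first_index (S :: s) @^-1` [set k.+1] =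
    first_index s @^-1` [set k] `\` S.
  apply/seteqP; split => x; rewrite /first_index/=.
    by case: ifPn => // xS [->]; split => // /mem_set; exact/negP.
  by move=> [-> nS]; rewrite memNset.
rewrite E; split; first exact: measurableD.
move=> ks; apply: le_trans (lek ks).
by apply: le_measure; [rewrite inE; exact: measurableD|rewrite inE|move=> x []].
Qed.

Lemma measurable_bigsetU_In (s : seq (set T)) :
  (forall S, List.In S s -> measurable S) ->
  measurable (\big[setU/set0]_(S <- s) S).
Proof.
elim: s => [|S s IH] sP; first by rewrite big_nil.
rewrite big_cons; apply: measurableU; first by apply: sP; left.
by apply: IH => S' S's; apply: sP; right.
Qed.

(* Lists of sets of measure at most [eta] cover measures arbitrarily close to
   1: a countable union of almost optimal covers that misses a set of positive
   measure could be improved by a small piece of that set. *)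
Lemma atomless_cover (eta : R) : atomless nu -> 0 < eta ->
  exists2 s, finely_covered eta s &
    ((1 - eta)%:E < nu (\big[setU/set0]_(S <- s) S))%E.
Proof.
move=> at_nu eta0; apply: contrapT => nex.
pose mass s := fine (nu (\big[setU/set0]_(S <- s) S)).
have mbig s : finely_covered eta s -> measurable (\big[setU/set0]_(S <- s) S).
  by move=> sP; apply: measurable_bigsetU_In => S /sP[].
have massE s : finely_covered eta s ->
    nu (\big[setU/set0]_(S <- s) S) = (mass s)%:E.
  by move=> sP; rewrite /mass fineK// fin_num_measure//; exact: mbig.
have mass_le s : finely_covered eta s -> mass s <= 1 - eta.
  move=> sP; rewrite leNgt; apply/negP => lt1; apply: nex; exists s => //.
  by rewrite massE.
have cat_cover s1 s2 : finely_covered eta s1 -> finely_covered eta s2 ->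
    finely_covered eta (s1 ++ s2).
  by move=> s1P s2P S /(@List.in_app_or _ _ _ _)[/s1P|/s2P].
pose E := [set mass s | s in finely_covered eta].
have supE : has_sup E.
  split; first by exists (mass [::]), [::].
  by exists (1 - eta) => _ [s sP <-]; exact: mass_le.
(* The masses of the lists [s k] approach the supremum; concatenating the first [k] of them makes
   the unions [F k] increasing. *)
have /choice[s sP] k : exists s, finely_covered eta s /\
    sup E - k.+1%:R^-1 < mass s.
  have k0 : 0 < k.+1%:R^-1 :> R by rewrite invr_gt0.
  by have [_ [s sP <-] lts] := sup_adherent k0 supE; exists s.
pose t k := flatten [seq s i | i <- iota 0 k].
have tP k : finely_covered eta (t k).
  rewrite /t; elim: k => [|k IH] //.
  rewrite -addn1 iotaD map_cat flatten_cat; apply: cat_cover => //=.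
  by rewrite cats0; exact: (sP _).1.
pose F k := \big[setU/set0]_(S <- t k) S.
have Fmono : {homo F : k l / (k <= l)%N >-> (k <= l)%O}.
  move=> k l kl; apply/subsetPset; rewrite /F /t -(subnKC kl) iotaD map_cat.
  by rewrite flatten_cat big_cat/=; exact: subsetUl.
have mF k : measurable (F k) by exact/mbig/tP.
have mU : measurable (\bigcup_k F k) by exact: bigcup_measurable.
have leU : (nu (\bigcup_k F k) <= (1 - eta)%:E)%E.
  have cF := nondecreasing_cvg_mu (mu := nu) mF mU Fmono.
  rewrite -(cvg_lim _ cF)//; apply: lime_le; first by apply/cvg_ex; eexists; exact: cF.
  by apply: nearW => k /=; rewrite massE// lee_fin mass_le.
have mC : measurable (~` \bigcup_k F k) by exact: measurableC.
(* Every list misses measure at least [eta], hence so does the limit union; [B] is a small piece of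
   what is missed. *)
have [|B [mB BC B0 Beta]] := atomless_subset_lt at_nu mC _ eta0.
  rewrite probability_setC//.
  move: leU; rewrite -(fineK (fin_num_measure nu _ mU)) -EFinB lee_fin lte_fin.
  by move=> leU; lra.
have Bf := fineK (fin_num_measure nu _ mB).
have [k hk] : exists k, k.+1%:R^-1 < fine (nu B).
  have B0' : 0 < fine (nu B) by rewrite -lte_fin Bf.
  have := @cvg_harmonic R; move=> /cvgr_lt /(_ _ B0') [k _ /(_ k)] hk.
  by exists k; apply: hk => /=.
have BP : finely_covered eta [:: B].
  by move=> S /= [<-|//]; split => //; exact: ltW.
have [sk ltk] := sP k.
have skF : \big[setU/set0]_(S <- s k) S `<=` \bigcup_k F k.
  move=> x xs; exists k.+1 => //; rewrite /F /t -addn1 iotaD map_cat flatten_cat.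
  by rewrite big_cat/=; right; rewrite cats0.
(* Since [1/(k+1) < nu B], appending [B] to [s k] pushes its mass beyond the supremum. *)
have skB : (mass (s k ++ [:: B]) = mass (s k) + fine (nu B)).
  apply: EFin_inj; rewrite -massE; last exact: cat_cover.
  rewrite EFinD -massE// Bf big_cat big_seq1 /=.
  rewrite measureU//; first exact: mbig.
  by apply/seteqP; split => // x [/skF xF /BC].
have : mass (s k ++ [:: B]) <= sup E.
  by apply: sup_upper_bound => //; exists (s k ++ [:: B]) => //; exact: cat_cover.
by rewrite skB; move: (k.+1%:R^-1) hk ltk => r hk ltk; lra.
Qed.

Lemma atomless_partition (eta : R) : atomless nu -> 0 < eta ->
  exists K (p : T -> 'I_K), forall k,
    measurable (p @^-1` [set k]) /\ (nu (p @^-1` [set k]) <= eta%:E)%E.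
Proof.
move=> at_nu eta0; have [s sP lts] := atomless_cover at_nu eta0.
(* One cell more than the list has sets: the last one is the uncovered remainder, of measure below
   [eta]. *)
exists (size s).+1, (fun x => inord (first_index s x)) => k.
have -> : (fun x => inord (first_index s x) : 'I_(size s).+1) @^-1` [set k] =
    first_index s @^-1` [set val k].
  have lt x : (first_index s x < (size s).+1)%N by rewrite ltnS find_size.
  apply/seteqP; split => x /= E; first by rewrite -E inordK.
  by apply: val_inj; rewrite /= inordK.
have [mk lek] := first_index_preimage k sP; split => //.
have [|geks] := ltnP k (size s); first exact: lek.
have mU : measurable (\big[setU/set0]_(S <- s) S).
  by apply: measurable_bigsetU_In => S /sP[].
have -> : first_index s @^-1` [set val k] = ~` \big[setU/set0]_(S <- s) S.
  have kE : val k = size s by apply/eqP; rewrite eqn_leq geks -ltnS ltn_ord.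
  rewrite bigsetU_first_index; apply/seteqP; split => x /=.
    by rewrite kE => ->; rewrite ltnn.
  move=> /negP; rewrite -leqNgt => le; apply/eqP.
  by rewrite kE eqn_leq le find_size.
rewrite probability_setC//.
move: lts; rewrite -(fineK (fin_num_measure nu _ mU)) -EFinB lee_fin lte_fin.
by move=> lts; lra.
Qed.

End atomless_partition.

(** * Averaging homomorphism densities over all graphs on the cells *)

Section random_graph.
Context (R : realType) d (T : measurableType d) (nu : probability T R).
Context (n : nat) (H : sgraph n).

Let indic_ge0 U (A : set U) z : 0 <= \1_A z :> R.
Proof. by rewrite indicE ler0n. Qed.

Let prod_indic_ge0 (A : set (T * T)) (x : n.-tuple T) :
  0 <= \prod_(e | edge H e) \1_A (tnth x e.1, tnth x e.2) :> R.
Proof. by apply: prodr_ge0 => e _; exact: indic_ge0. Qed.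

Lemma hom_density_indic_measurable (A : set (T * T)) : measurable A ->
  measurable_fun [set: n.-tuple T]
    (fun x => (\prod_(e | edge H e) \1_A (tnth x e.1, tnth x e.2))%:E : \bar R).
Proof.
move=> mA; apply/measurable_EFinP; under eq_fun do rewrite -big_filter.
apply: measurable_prod => e _; apply: measurableT_comp.
  exact: measurable_indic.
by apply: measurable_fun_pair; exact: measurable_tnth.
Qed.

Lemma hom_density_indic_le1 (A : set (T * T)) : measurable A ->
  (0 <= hom_density nu H (\1_A : _ -> R) <= 1)%E.
Proof.
move=> mA; rewrite /hom_density; apply/andP; split.
  by apply: integral_ge0 => x _; rewrite lee_fin; exact: prod_indic_ge0.
rewrite (@le_trans _ _ (\int[power_probability nu n]_x (cst 1%E) x)%E)//.
  apply: ge0_le_integral => //.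
  - by move=> x _; rewrite lee_fin; exact: prod_indic_ge0.
  - exact: hom_density_indic_measurable.
  - move=> x _ /=; rewrite lee_fin; apply: prodr_ile1 => e _.
    by rewrite indicE ler0n lern1 leq_b1.
by rewrite integral_cst// mul1e; exact: probability_le1.
Qed.

Variables (K : nat) (p : T -> 'I_K) (eta : R).
Hypothesis eta_ge0 : 0 <= eta.
Hypothesis mp : forall k, measurable (p @^-1` [set k]).
Hypothesis nu_le : forall k, (nu (p @^-1` [set k]) <= eta%:E)%E.

Definition block_pair (z : T * T) : {set 'I_K} := [set p z.1; p z.2]%SET.

(** [G] lists the non-edges, so that a tuple contributes exactly when [G] is disjoint from the pairs
    of cells it uses. Singletons are allowed as loops; the other sets in [G] are free and only scale
    all counts by a common factor. *)
Definition block_graph (G : {set {set 'I_K}}) : set (T * T) :=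
  [set z | block_pair z \notin G].

Lemma block_graphC G : block_graph (~: G)%SET = ~` block_graph G.
Proof.
rewrite /block_graph; apply/seteqP; split => z /=; rewrite inE negbK => zG.
  by apply/negP; rewrite negbK.
by apply/negPn/negP.
Qed.

Lemma block_graph_sym G x y : block_graph G (x, y) = block_graph G (y, x).
Proof. by rewrite /block_graph/= /block_pair finset.setUC. Qed.

Lemma measurable_block_graph G : measurable (block_graph G).
Proof.
have -> : block_graph G =
    \bigcup_(k in [set k : 'I_K * 'I_K | [set k.1; k.2]%SET \notin G])
      ((p @^-1` [set k.1]) `*` (p @^-1` [set k.2])).
  apply/seteqP; split => [[x y] nG|[x y] [[k l]/= nG] []/= xk yl].
    by exists (p x, p y).
  by rewrite /block_graph/= /block_pair/= xk yl.
apply: fin_bigcup_measurable => [|k _]; first exact: finite_finset.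
exact: measurableX.
Qed.

Lemma sum_cells : (\sum_k nu (p @^-1` [set k]) = 1)%E.
Proof.
rewrite -(probability_setT nu) -[nu setT]mul1e -integral_cst//.
transitivity (\int[nu]_x (\sum_k (\1_(p @^-1` [set k]) x : R)%:E))%E.
  rewrite ge0_integral_sum//.
  - by apply: eq_bigr => k _; rewrite integral_indic// setIT.
  - by move=> k; apply/measurable_EFinP; exact: measurable_indic.
apply: eq_integral => x _; rewrite (bigD1 (p x))//= big1.
  by rewrite adde0 indicE mem_set.
by move=> k kx; rewrite indicE memNset//= => /esym /eqP; exact/negP.
Qed.

Let cells (i j : 'I_n) k (l : 'I_n) : set T :=
  if (l == i) || (l == j) then p @^-1` [set k] else setT.

(** Written as a box constraining only coordinates [i] and [j], so that [power_probabilityE]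
    computes its measure. *)
Let collide (i j : 'I_n) k : set (n.-tuple T) :=
  [set x | forall l, cells i j k l (tnth x l)].

Lemma measurable_collide i j k : measurable (collide i j k).
Proof.
have -> : collide i j k = \bigcap_(l in [set: 'I_n]) ((@tnth n T ^~ l) @^-1` cells i j k l).
  by apply/seteqP; split=> [x Ax l _|x Ax l]; [exact: Ax|exact: (Ax l I)].
apply: fin_bigcap_measurable => // l _.
rewrite -[X in measurable X]setTI; apply: measurable_tnth => //.
by rewrite /cells; case: ifP.
Qed.

(** The left side is the sum of the squared cell measures, and one factor of each square is at most
    [eta]. *)
Lemma collision_le i j : i != j ->
  (\sum_k power_probability nu n (collide i j k) <= eta%:E)%E.
Proof.
move=> ij; rewrite -[leRHS]mule1 -sum_cells ge0_sume_distrr//.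
apply: lee_sum => k _; rewrite power_probabilityE; last first.
  by move=> l; rewrite /cells; case: ifP.
rewrite (bigD1 i)//= (bigD1 j) ?(eq_sym j)//= big1 ?mule1.
  by rewrite /cells !eqxx orbT/=; apply: lee_wpmul2r => //; exact: nu_le.
by move=> l /andP[li lj]; rewrite /cells (negbTE li) (negbTE lj) probability_setT.
Qed.

(** Edges are stored with increasing endpoints, so two edges giving the same unordered pair of cells
    cannot be reversals of each other. *)
Lemma card_edge_blocks (x : n.-tuple T) : injective (fun i => p (tnth x i)) ->
  #|[set block_pair (tnth x e.1, tnth x e.2) | e in edge H]%SET| = #|edge H|.
Proof.
move=> inj; apply: card_in_imset => -[i j] [k l]/=.
rewrite !inE/= => /andP[ij _] /andP[kl _] /setP E.
have := E (p (tnth x i)); have := E (p (tnth x j)); have := E (p (tnth x k)).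
rewrite !inE !eqxx ?orbT/=.
have eqp a b : (p (tnth x a) == p (tnth x b)) = (a == b) by exact: (inj_eq inj).
rewrite !eqp => /orP[/eqP ki|/eqP kj].
  subst k => /esym/orP[/eqP ji|/eqP -> //]; subst j; by rewrite ltnn in ij.
subst k => _ /esym/orP[/eqP ij'|/eqP il]; first by rewrite ij' ltnn in ij.
by subst l; have := ltn_trans ij kl; rewrite ltnn.
Qed.

(** Each product is 0 or 1, and it is 1 exactly when [G] avoids all pairs of cells used by the
    edges. *)
Lemma sum_block_graphs (x : n.-tuple T) :
  \sum_(G : {set {set 'I_K}})
    \prod_(e | edge H e) (\1_(block_graph G) (tnth x e.1, tnth x e.2) : R) =
  #|powerset (~: [set block_pair (tnth x e.1, tnth x e.2) | e in edge H])%SET|%:R.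
Proof.
rewrite -sum1_card natr_sum [RHS]big_mkcond/=; apply: eq_bigr => G _.
rewrite powersetE -finset.disjoints_subset; case: ifPn => [disj|].
  rewrite big1// => e He; rewrite indicE mem_set// /block_graph/=.
  apply/negP => eG; move/pred0P/(_ (block_pair (tnth x e.1, tnth x e.2))): disj.
  rewrite /= eG/= => /negP; apply.
  by apply/imsetP; exists e.
move/pred0Pn => [S /andP[/= SG /imsetP[e He SE]]].
rewrite (bigD1 e)//= indicE memNset ?mul0r//.
by rewrite /block_graph/= -SE SG.
Qed.

Lemma sum_block_graphs_le (x : n.-tuple T) :
  \sum_(G : {set {set 'I_K}})
    \prod_(e | edge H e) (\1_(block_graph G) (tnth x e.1, tnth x e.2) : R) <=
  #|{set {set 'I_K}}|%:R * (2^-1 ^+ #|edge H| +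
    \sum_(ij : 'I_n * 'I_n | ij.1 != ij.2) \sum_k \1_(collide ij.1 ij.2 k) x).
Proof.
rewrite sum_block_graphs card_powerset.
have sum0 (P : pred ('I_n * 'I_n)) :
    0 <= \sum_(ij | P ij) \sum_k (\1_(collide ij.1 ij.2 k) x : R).
  by apply: sumr_ge0 => ij _; apply: sumr_ge0.
have cardG : #|{set {set 'I_K}}| = (2 ^ #|{set 'I_K}|)%N.
  by rewrite -[LHS]cardsT -powersetT card_powerset cardsT.
have [inj|] := boolP [forall i, forall j, (p (tnth x i) == p (tnth x j)) ==> (i == j)].
  have {}inj : injective (fun i => p (tnth x i)).
    by move=> i j ij; apply/eqP; move/forallP/(_ i)/forallP/(_ j)/implyP: inj; apply; apply/eqP.
  (* Without collisions the edges use exactly [#|edge H|] distinct pairs, so a fraction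
     [2^-1 ^+ #|edge H|] of all [G] avoids them. *)
  rewrite mulrDr ler_wpDr ?mulr_ge0//.
  have := cardsC [set block_pair (tnth x e.1, tnth x e.2) | e in edge H]%SET.
  rewrite card_edge_blocks// cardG => <-.
  rewrite natrX natrX exprD mulrAC -exprMn mulfV ?expr1n ?mul1r//.
rewrite negb_forall => /existsP[i]; rewrite negb_forall => /existsP[j].
rewrite negb_imply => /andP[/eqP pij ij].
(* With a collision the trivial bound by the number of all [G] suffices, since the collision of [i]
   and [j] supplies a summand 1. *)
apply: (@le_trans _ _ #|{set {set 'I_K}}|%:R).
  by rewrite cardG ler_nat leq_pexp2l// max_card.
rewrite ler_peMr// ler_wpDl ?exprn_ge0// (bigD1 (i, j))//= ler_wpDr//.
rewrite (bigD1 (p (tnth x i)))//= ler_wpDr ?sumr_ge0//.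
rewrite indicE mem_set// => l; rewrite /cells; case: ifPn => // /orP[|]/eqP -> //=.
Qed.

(** The pointwise bound is integrated; each of the at most [n * n] ordered pairs of vertices costs
    [eta] by [collision_le]. *)
Lemma sum_hom_density_le :
  (\sum_(G : {set {set 'I_K}}) hom_density nu H (\1_(block_graph G) : _ -> R) <=
   (#|{set {set 'I_K}}|%:R * (2^-1 ^+ #|edge H| + (n * n)%:R * eta))%:E)%E.
Proof.
rewrite /hom_density -ge0_integral_sum//; last 2 first.
- by move=> G; apply: hom_density_indic_measurable; exact: measurable_block_graph.
- by move=> G x _; rewrite lee_fin; exact: prod_indic_ge0.
pose M : R := #|{set {set 'I_K}}|%:R.
have mcol ij k : measurable_fun [set: n.-tuple T]
    (fun x => (\1_(collide ij.1 ij.2 k) x : R)).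
  by apply: measurable_indic; exact: measurable_collide.
have mcolE : measurable_fun [set: n.-tuple T] (fun x =>
    \sum_(ij : 'I_n * 'I_n | ij.1 != ij.2) \sum_k (\1_(collide ij.1 ij.2 k) x : R)).
  under eq_fun do rewrite -big_filter.
  by apply: measurable_sum => ij; apply: measurable_sum.
apply: (@le_trans _ _ (\int[power_probability nu n]_x
  ((M * 2^-1 ^+ #|edge H|)%:E + M%:E *
    (\sum_(ij : 'I_n * 'I_n | ij.1 != ij.2) \sum_k (\1_(collide ij.1 ij.2 k) x : R))%:E))%E).
  apply: ge0_le_integral => //.
  - by move=> x _; apply: sume_ge0 => G _; rewrite lee_fin; exact: prod_indic_ge0.
  - by apply: emeasurable_sum => G;
      apply: hom_density_indic_measurable; exact: measurable_block_graph.
  - apply: emeasurable_funD => //; apply: measurable_funeM; exact/measurable_EFinP.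
  - by move=> x _; rewrite sumEFin -EFinM -EFinD lee_fin -mulrDr sum_block_graphs_le.
have sum0 x : 0 <= \sum_(ij : 'I_n * 'I_n | ij.1 != ij.2)
    \sum_k (\1_(collide ij.1 ij.2 k) x : R).
  by apply: sumr_ge0 => ij _; apply: sumr_ge0.
rewrite ge0_integralD//; last 3 first.
- by move=> x _; rewrite lee_fin mulr_ge0// exprn_ge0.
- by move=> x _; rewrite -EFinM lee_fin mulr_ge0.
- by apply: measurable_funeM; exact/measurable_EFinP.
rewrite integral_cst// [X in (_ * X + _)%E](_ : _ = 1%E); last exact: probability_setT.
rewrite mule1 ge0_integralZl//; last 3 first.
- exact/measurable_EFinP.
- by move=> x _; rewrite lee_fin.
- by rewrite lee_fin.
rewrite mulrDr EFinD leeD2l// EFinM lee_wpmul2l ?lee_fin//.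
under eq_integral do rewrite -sumEFin -big_filter.
rewrite ge0_integral_sum//; last 2 first.
- by move=> ij; apply/measurable_EFinP; apply: measurable_sum.
- by move=> ij x _; rewrite lee_fin sumr_ge0.
rewrite big_filter.
apply: (@le_trans _ _ (\sum_(ij : 'I_n * 'I_n | ij.1 != ij.2) eta%:E)%E).
  apply: lee_sum => ij nij; apply: le_trans (collision_le nij).
  under eq_integral do rewrite -sumEFin.
  rewrite ge0_integral_sum//; last by move=> k; exact/measurable_EFinP.
  by apply: lee_sum => k _; rewrite integral_indic ?setIT//; exact: measurable_collide.
rewrite sumEFin lee_fin sumr_const -[leLHS]mulr_natl ler_wpM2r//.
by rewrite ler_nat (leq_trans (max_card _))// card_prod !card_ord.
Qed.

End random_graph.

(** * The power mean inequality for two numbers, free of divisions *)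

Lemma power_mean (R : realDomainType) (a b : R) k : 0 <= a -> 0 <= b ->
  (a + b) ^+ k * 2 <= 2 ^+ k * (a ^+ k + b ^+ k).
Proof.
move=> a0 b0; elim: k => [|k IH]; first by rewrite !expr0 !mul1r.
have ab : (a + b) * (a ^+ k + b ^+ k) <= 2 * (a ^+ k.+1 + b ^+ k.+1).
  (* Chebyshev's sum inequality: [a - b] and [a ^+ k - b ^+ k] have the same sign. *)
  suff : 0 <= (a - b) * (a ^+ k - b ^+ k) by rewrite !exprS; lra.
  have [ba|/ltW ab] := leP b a.
    by rewrite mulr_ge0// subr_ge0// lerXn2r.
  by rewrite mulr_le0// subr_le0// lerXn2r.
rewrite exprS -mulrA (le_trans (ler_wpM2l _ IH)) ?addr_ge0//.
by rewrite mulrCA exprSr -[leRHS]mulrA ler_wpM2l// exprn_ge0.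
Qed.

(** * Almost isometric copies of two-dimensional l^1 and the two moduli *)

Section normed.
Context (R : realType) (V : lmodType R) (null X : set V) (N : V -> R).
Hypothesis normN : norm_modulo null X N.

(* If [a >= b] then [b^-1 *: (a *: f + b *: g)] is [f + g] plus a nonnegative
   multiple of [f]. *)
Lemma norm_add_unit_ge (f g : V) (a b c delta : R) : X f -> X g -> N f = 1 -> N g = 1 ->
  0 < c -> c <= a -> c <= b -> a + b <= 1 + delta -> 0 <= delta ->
  N (a *: f + b *: g) = 1 -> 2 - delta / c <= N (f + g).
Proof.
wlog ba : f g a b / b <= a.
  move=> H Xf Xg Nf Ng c0 ca cb abd d0 N1.
  have [ba|/ltW ab] := leP b a; first exact: (H f g a b).
  by rewrite [f + g]addrC; apply: (H g f b a) => //; rewrite addrC.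
move=> Xf Xg Nf Ng c0 ca cb abd d0 N1.
have [[X0 XD XZ] _ NZ ND] := normN.
have b0 : 0 < b by exact: lt_le_trans cb.
have E : b^-1 *: (a *: f + b *: g) = (f + g) + (a / b - 1) *: f.
  rewrite scalerDr !scalerA mulVf ?gt_eqF// scale1r scalerBl scale1r.
  by rewrite mulrC addrCA addrAC subrr add0r addrC.
have := ND _ _ (XD _ _ Xf Xg) (XZ (a / b - 1) _ Xf).
rewrite -E !NZ//; last by apply: XD; exact: XZ.
rewrite N1 Nf !mulr1 gtr0_norm ?invr_gt0// ger0_norm; last first.
  by rewrite subr_ge0 ler_pdivlMr// mul1r.
(* The triangle inequality now reads [1/b <= N (f + g) + a/b - 1]; with [1 >= a + b - delta] it
   gives [N (f + g) >= 2 - delta/b]. *)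
move=> le; have : delta / b <= delta / c by rewrite ler_wpM2l// lef_pV2.
have : b^-1 * (a + b) <= b^-1 * (1 + delta) by rewrite ler_wpM2l// invr_ge0 ltW.
rewrite !mulrDr mulVf ?gt_eqF// mulr1 [b^-1 * delta]mulrC [b^-1 * a]mulrC.
by lra.
Qed.

Lemma norm_normalize u : X u -> 0 < N u -> N ((N u)^-1 *: u) = 1.
Proof.
have [_ _ NZ _] := normN => Xu u0.
by rewrite NZ// gtr0_norm ?invr_gt0// mulVf// gt_eqF.
Qed.

Lemma norm_add_normalized_ge u v c delta : X u -> X v ->
  0 < c -> c <= N u -> c <= N v -> N u + N v <= 1 + delta -> 0 <= delta ->
  N (u + v) = 1 -> 2 - delta / c <= N ((N u)^-1 *: u + (N v)^-1 *: v).
Proof.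
have [[_ _ XZ] _ _ _] := normN => Xu Xv c0 cu cv uv d0 N1.
have u0 := lt_le_trans c0 cu; have v0 := lt_le_trans c0 cv.
apply: (norm_add_unit_ge (XZ _ _ Xu) (XZ _ _ Xv) (norm_normalize Xu u0)
  (norm_normalize Xv v0) c0 cu cv uv d0).
by rewrite !scalerA !mulfV ?gt_eqF// !scale1r.
Qed.

(** Such [f] and [g] behave nearly like the basis vectors of two-dimensional l^1, whose unit sphere
    has both segments and corners. *)
Hypothesis l1_pairs : forall delta : R, 0 < delta -> exists f g,
  [/\ X f, X g, N f = 1, N g = 1 & 2 - delta <= N (f + g)] /\
  (forall s, 0 <= s -> N (f - s *: g) = N (f + s *: g)).

Lemma l1_pairs_not_uniformly_convex : ~ uniformly_convex X N.
Proof.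
have [_ _ NZ _] := normN; have [[_ XD _] _ _ _] := normN.
move=> /(_ 1); rewrite ltr01 ler1n => /(_ isT); apply/negP; rewrite -leNgt.
apply/lee_addgt0Pr => e e0; rewrite add0e.
(* The cap at 1 ensures [N (f - g) = N (f + g) >= 1], the separation at which the modulus is
   tested. *)
have [|f [g [[Xf Xg Nf Ng Nfg] sym]]] := l1_pairs (delta := Num.min e 1).
  by rewrite lt_min e0 ltr01.
have [me m1] : Num.min e 1 <= e /\ Num.min e 1 <= 1 by rewrite !ge_min !lexx orbT.
apply: (@le_trans _ _ (1 - N (2^-1 *: (f + g)))%:E).
  apply: ereal_inf_lbound; exists f, g; split => //; split => //.
  by rewrite -[g]scale1r sym// scale1r; lra.
rewrite lee_fin NZ; last exact: XD.
rewrite ger0_norm ?invr_ge0//; lra.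
Qed.

Lemma l1_pairs_not_uniformly_smooth : ~ uniformly_smooth X N.
Proof.
have [[X0 XD XZ] _ NZ ND] := normN => smooth.
(* Since [f + g = (f + s *: g) + (1 - s) *: g], the norm of [f + s *: g] is at least [1 + s - e].
   The quotient in the limit therefore stays at least 1. *)
have ge_s s : 0 < s <= 1 -> (s%:E <= modulus_of_smoothness X N s)%E.
  move=> /andP[s0 s1]; apply/lee_addgt0Pr => e e0.
  have [f [g [[Xf Xg Nf Ng Nfg] sym]]] := l1_pairs e0.
  have Nsg : N (s *: g) = s by rewrite NZ// Ng mulr1 gtr0_norm.
  rewrite -leeBlDr//; apply: (@le_trans _ _
      (2^-1 * (N (f + s *: g) + N (f - s *: g) - 2))%:E).
    rewrite (sym _ (ltW s0)) -EFinB lee_fin.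
    have := ND _ _ (XD _ _ Xf (XZ s _ Xg)) (XZ (1 - s) _ Xg).
    rewrite -addrA -scalerDl subrKC scale1r [N (_ *: _)]NZ// Ng mulr1.
    rewrite ger0_norm ?subr_ge0//; lra.
  apply: ereal_sup_ubound; exists f, (s *: g); split => //; split => //.
  exact: XZ.
have : (1 <= (0 : \bar R))%E.
  rewrite -(cvg_lim _ smooth)//; apply: lime_ge.
    by apply/cvg_ex; eexists; exact: smooth.
  near=> s.
  have s0 : 0 < s by near: s; exact: nbhs_right_gt.
  have s1 : s <= 1 by near: s; exact: nbhs_right_le.
  have -> : 1%E = (s%:E * (s^-1)%:E)%E by rewrite -EFinM mulfV ?gt_eqF.
  apply: lee_wpmul2r; last by apply: ge_s; rewrite s0.
  by rewrite lee_fin invr_ge0 ltW.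
by rewrite lee_fin ler10.
Unshelve. all: by end_near. Qed.

End normed.

(** * Near-equality in the power mean inequality, and an averaging principle *)

Lemma near_extremal_power_mean (R : realFieldType) (a b m : R) e : (1 < e)%N ->
  m <= 1 / 16 -> 0 <= a -> 0 <= b -> 1 <= a + b ->
  2 ^+ e * (a ^+ e + b ^+ e) <= 2 * (1 + m) -> 1 / 4 <= a /\ a + b <= 1 + m.
Proof.
move=> e2 m16 a0 b0 ab1 le2; split; last first.
  have abe : (a + b) ^+ e <= 1 + m.
    by have := le_trans (power_mean e a0 b0) le2; lra.
  by apply: le_trans abe; rewrite ler_eXnr// ltnW.
(* If [a < 1/4] then [2 * b > 3/2], and [e >= 2] makes [(2 * b) ^+ e] at least 9/4, above
   [2 * (1 + 1/16) = 17/8]. *)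
rewrite leNgt; apply/negP => a4.
have : (3 / 2) ^+ 2 <= (3 / 2) ^+ e :> R by rewrite ler_weXn2l//; lra.
have : (3 / 2) ^+ e <= (2 * b) ^+ e by rewrite lerXn2r// ?nnegrE; lra.
have : (2 * b) ^+ e <= 2 ^+ e * (a ^+ e + b ^+ e).
  by rewrite exprMn ler_wpM2l ?exprn_ge0// lerDr exprn_ge0.
lra.
Qed.

(** An injective [h] permutes the finite type, so [f i] and [f (h i)] have the same average. The
    element [i0] makes the contradicting sum inequality strict. *)
Lemma exists_add_le_average (R : realDomainType) (I : finType) (i0 : I)
    (f : I -> R) (h : I -> I) (x : R) :
  injective h -> \sum_i f i <= #|I|%:R * x -> exists i, f i + f (h i) <= 2 * x.
Proof.
move=> injh sumle; apply/existsP; apply: contraT; rewrite negb_exists => /forallP nex.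
have : \sum_(i : I) 2 * x < \sum_i (f i + f (h i)).
  apply: ltr_sum; first by apply/hasP; exists i0; rewrite ?mem_index_enum.
  by move=> i _; rewrite ltNge.
rewrite big_split/= -(reindex_inj injh (P := xpredT) (F := f))/=.
rewrite sumr_const -[ltLHS]mulr_natl; lra.
Qed.

(** * Graph norms of indicator functions *)

Section graph_norm_indic.
Context (R : realType) d (T : measurableType d) (nu : probability T R).
Context (n : nat) (H : sgraph n).
Implicit Types A B : set (T * T).

Let N : (T * T -> R) -> R := graph_norm nu H.
Let X : set (T * T -> R) := graph_space nu H.
Let dens A : R := fine (hom_density nu H (\1_A : T * T -> R)).

Let abs_indic A : (fun z => `|\1_A z : R|) = \1_A.
Proof. by apply/funext => z; rewrite ger0_norm// indicE ler0n. Qed.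

Let indic_setC A z : \1_(~` A) z = 1 - \1_A z :> R.
Proof. by rewrite !indicE in_setC; case: (_ \in _); rewrite ?subrr ?subr0. Qed.

Let indicT_split A : (\1_setT : T * T -> R) = \1_A + \1_(~` A).
Proof.
apply/funext => z; rewrite indicT; apply/esym.
rewrite -[LHS]/(\1_A z + \1_(~` A) z) indic_setC.
by rewrite addrC subrK.
Qed.

Lemma hom_density_indicE A : measurable A ->
  hom_density nu H (\1_A : T * T -> R) = (dens A)%:E.
Proof.
move=> mA; rewrite /dens fineK//.
have /andP[ge0 le1] := hom_density_indic_le1 nu H mA.
by rewrite ge0_fin_numE// (le_lt_trans le1)// ltry.
Qed.

Lemma indic_graph_space A : measurable A ->
  (forall x y, A (x, y) = A (y, x)) -> X \1_A.
Proof.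
move=> mA symA; split; first exact: measurable_indic.
  by move=> x y; rewrite !indicE; congr (nat_of_bool _)%:R;
    apply/idP/idP => /set_mem xy; apply/mem_set; move: xy; rewrite symA.
by rewrite abs_indic hom_density_indicE// ltry.
Qed.

Lemma graph_norm_abs (V W : T * T -> R) : (forall z, `|V z| = `|W z|) ->
  N V = N W.
Proof. by move=> VW; rewrite /N /graph_norm (_ : (fun z => `|V z|) = fun z => `|W z|)//; apply/funext. Qed.

(** The norm sees only absolute values, and with disjoint supports these do not depend on the sign
    of the second term. *)
Lemma graph_norm_disjoint A (a b s : R) :
  N (a *: \1_A - s *: (b *: \1_(~` A))) = N (a *: \1_A + s *: (b *: \1_(~` A))).
Proof.
apply: graph_norm_abs => z.
rewrite -[LHS]/(`|a * \1_A z - s * (b * \1_(~` A) z)|).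
rewrite -[RHS]/(`|a * \1_A z + s * (b * \1_(~` A) z)|).
rewrite indic_setC indicE; case: (_ \in _).
  by rewrite subrr !mulr0 subr0 addr0.
by rewrite mulr0 sub0r add0r normrN.
Qed.

Lemma graph_norm_indicX A : (0 < #|edge H|)%N -> N \1_A ^+ #|edge H| = dens A.
Proof.
move=> e0; rewrite /N /graph_norm abs_indic -/(dens A).
rewrite -powR_mulrn ?powR_ge0// -powRrM mulVf ?pnatr_eq0 -?lt0n// powRr1//.
by apply: fine_ge0; apply: integral_ge0 => x _; rewrite lee_fin prodr_ge0// => e _;
  rewrite indicE ler0n.
Qed.

Lemma graph_norm1 : N \1_setT = 1.
Proof.
rewrite /N /graph_norm abs_indic -/(dens setT) [dens setT](_ : _ = 1) ?powR1//.
rewrite /dens /hom_density; under eq_integral.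
  by move=> x _; rewrite big1; [over|move=> e _; rewrite indicE mem_set].
rewrite integral_cst// mul1e [X in fine X](_ : _ = 1%E)//.
exact: probability_setT.
Qed.

Lemma weakly_norming_edge : weakly_norming nu H -> (0 < #|edge H|)%N.
Proof.
move=> [[X0 _ _] N0 _ _]; rewrite lt0n; apply/eqP => e0.
have : N 0 = 0 by apply/(N0 _ X0); exact: aeW.
by rewrite /N /graph_norm e0 invr0 powRr0 => /eqP; rewrite oner_eq0.
Qed.

(** If the norm vanished, [\1_A] would be null, although it equals 1 on a square of positive
    measure. *)
Lemma graph_norm_indic_gt0 (B : set T) A : weakly_norming nu H ->
  measurable A -> (forall x y, A (x, y) = A (y, x)) ->
  measurable B -> (0 < nu B)%E -> B `*` B `<=` A -> 0 < N \1_A.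
Proof.
move=> [_ N0 _ _] mA symA mB nuB BA; rewrite lt0r powR_ge0 andbT; apply/eqP.
move=> /(N0 _ (indic_graph_space mA symA)) [S [mS S0 AS]].
have : ((nu \x nu) (B `*` B) <= 0)%E.
  rewrite -S0; apply: le_measure; rewrite ?inE//; first exact: measurableX.
  move=> z /BA Az; apply: AS => /= A0; have := A0 I.
  by rewrite indicE mem_set// => /eqP; rewrite oner_eq0.
by rewrite product_measure1E// leNgt mule_gt0.
Qed.

Lemma graph_norm_indic_split A : weakly_norming nu H ->
  measurable A -> (forall x y, A (x, y) = A (y, x)) ->
  1 <= N \1_A + N \1_(~` A).
Proof.
move=> [_ _ _ ND] mA symA; rewrite -graph_norm1 (indicT_split A).
apply: ND; apply: indic_graph_space => //; first exact: measurableC.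
by move=> x y; exact: congr1 (symA x y).
Qed.

(** * Splitting the constant 1 into two indicators with almost additive norms *)

Lemma weakly_norming_split1 : atomless nu -> weakly_norming nu H ->
  #|edge H| = 1%N -> exists A,
  [/\ measurable A, forall x y, A (x, y) = A (y, x),
      0 < N \1_A, 0 < N \1_(~` A) & N \1_A + N \1_(~` A) <= 1].
Proof.
move=> at_nu wn e1.
have [||B [mB _ B0 B1]] := at_nu setT; rewrite ?probability_setT//.
have mBB : measurable (B `*` B) by exact: measurableX.
have symB x y : (B `*` B) (x, y) = (B `*` B) (y, x).
  by apply/propext; split => -[].
have mC : measurable (~` (B `*` B)) by exact: measurableC.
exists (B `*` B); split => //.
- exact: (@graph_norm_indic_gt0 B).
(* The complement of the square of [B] contains the square of the complement of [B], which has
   positive measure because [nu B < 1]. *)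
- apply: (@graph_norm_indic_gt0 (~` B)) => //.
  + by move=> x y; exact: congr1 (symB x y).
  + exact: measurableC.
  + rewrite probability_setC//; move: B1; rewrite probability_setT.
    by rewrite -(fineK (fin_num_measure nu _ mB)) -EFinB !lte_fin; lra.
  + by move=> [x y] [nx _] [].
- rewrite -[N \1_(B `*` B)]expr1 -[N \1_(~` _)]expr1 -e1.
  rewrite !graph_norm_indicX ?e1// -lee_fin EFinD -!hom_density_indicE//.
  rewrite /hom_density -ge0_integralD//; last 4 first.
  + by move=> x _; rewrite lee_fin prodr_ge0// => e _; rewrite indicE ler0n.
  + exact: hom_density_indic_measurable.
  + by move=> x _; rewrite lee_fin prodr_ge0// => e _; rewrite indicE ler0n.
  + exact: hom_density_indic_measurable.
  (* With a single edge the product has one factor, so the two integrands add up to 1 at every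
     point. *)
  have /card1P[e He] : #|edge H| == 1%N by rewrite e1.
  have eqe : edge H =1 pred1 e by move=> f; have := He f; rewrite !inE.
  under eq_integral.
    move=> x _; rewrite !(eq_bigl _ _ eqe) !big_pred1_eq -EFinD (indic_setC (B `*` B)) subrKC.
    over.
  by rewrite integral_cst// mul1e; exact: probability_le1.
Qed.

Lemma weakly_norming_split2 (delta : R) : atomless nu -> weakly_norming nu H ->
  (1 < #|edge H|)%N -> 0 < delta -> exists A,
  [/\ measurable A, forall x y, A (x, y) = A (y, x),
      1 / 4 <= N \1_A, 1 / 4 <= N \1_(~` A) & N \1_A + N \1_(~` A) <= 1 + delta].
Proof.
move=> at_nu wn e2 delta0; set e := #|edge H| in e2.
have e0 : (0 < #|edge H|)%N by exact: ltnW.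
(* The cap 1/16 is the one that [near_extremal_power_mean] requires. *)
pose m : R := Num.min delta (1 / 16).
have m0 : 0 < m by rewrite lt_min delta0/=; lra.
have [md m16] : m <= delta /\ m <= 1 / 16 by rewrite !ge_min !lexx orbT.
(* Chosen so that the collision error, scaled by [2 ^+ e], is at most [m]; the successor keeps the
   denominator nonzero. *)
pose eta : R := m / (2 ^+ e * (n * n).+1%:R).
have eta0 : 0 < eta by rewrite divr_gt0// mulr_gt0// exprn_gt0.
have etam : 2 ^+ e * ((n * n)%:R * eta) <= m.
  rewrite [leLHS](_ : _ = m * ((n * n)%:R / (n * n).+1%:R)).
    by rewrite ler_piMr ?(ltW m0)// ler_pdivrMr// mul1r ler_nat.
  have P0 : 2 ^+ e != 0 :> R by rewrite expf_neq0.
  have k0 : (n * n).+1%:R != 0 :> R by rewrite pnatr_eq0.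
  rewrite /eta; move: (2 ^+ e) ((n * n).+1%:R) ((n * n)%:R : R) P0 k0.
  by move=> P k l P0 k0; field; rewrite P0 k0.
have [K [p pP]] := atomless_partition at_nu eta0.
pose G0 := {set {set 'I_K}}.
pose bg (G : G0) := block_graph p G.
have mbg G : measurable (bg G) by apply: measurable_block_graph => k; have [] := pP k.
have bgC G : ~` bg G = bg (~: G)%SET by rewrite /bg block_graphC.
pose Y : R := 2^-1 ^+ e + (n * n)%:R * eta.
have sumle : \sum_(G : G0) dens (bg G) <= #|G0|%:R * Y.
  rewrite -lee_fin -sumEFin; under eq_bigr do rewrite -hom_density_indicE//.
  by apply: sum_hom_density_le; [exact: ltW|move=> k; have [] := pP k|move=> k; have [] := pP k].
(* Complementing [G] is injective and complements the set, so a single [G] controls the set and its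
   complement together. *)
have [G leG] : exists G : G0, dens (bg G) + dens (~` bg G) <= 2 * Y.
  have [] := exists_add_le_average finset.set0 (can_inj (@finset.setCK _)) sumle.
  by move=> G leG; exists G; rewrite bgC.
have symG x y : bg G (x, y) = bg G (y, x) by exact: block_graph_sym.
exists (bg G).
have := graph_norm_indic_split wn (mbg G) symG.
move: leG; rewrite -!graph_norm_indicX// -/e.
set a := N \1_(bg G); set b := N \1_(~` bg G) => leG ab1.
have a0 : 0 <= a by exact: powR_ge0.
have b0 : 0 <= b by exact: powR_ge0.
have le2 : 2 ^+ e * (a ^+ e + b ^+ e) <= 2 * (1 + m).
  apply: le_trans (ler_wpM2l _ leG) _; first exact: exprn_ge0.
  rewrite mulrCA ler_wpM2l// /Y mulrDr -exprMn mulfV// expr1n lerD2l//.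
have [ab4 abm] := near_extremal_power_mean e2 m16 a0 b0 ab1 le2.
have ba1 : 1 <= b + a by rewrite addrC.
have le2' : 2 ^+ e * (b ^+ e + a ^+ e) <= 2 * (1 + m) by rewrite [b ^+ e + _]addrC.
have [ba4 _] := near_extremal_power_mean e2 m16 b0 a0 ba1 le2'.
split; [exact: mbg|exact: symG|exact: ab4|exact: ba4|].
by apply: le_trans abm _; rewrite lerD2l.
Qed.

(** The bound [c] is fixed before [delta] because normalizing turns an error [delta] into
    [delta / c]. With one edge, a single set serves every [delta]. *)
Lemma weakly_norming_split : atomless nu -> weakly_norming nu H ->
  exists2 c : R, 0 < c & forall delta, 0 < delta -> exists A,
  [/\ measurable A, forall x y, A (x, y) = A (y, x),
      c <= N \1_A, c <= N \1_(~` A) & N \1_A + N \1_(~` A) <= 1 + delta].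
Proof.
move=> at_nu wn; have := weakly_norming_edge wn.
rewrite leq_eqVlt => /orP[/eqP/esym e1|e2].
  have [A [mA symA a0 b0 ab]] := weakly_norming_split1 at_nu wn e1.
  exists (Num.min (N \1_A) (N \1_(~` A))).
    by rewrite lt_min; apply/andP; split; [exact: a0|exact: b0].
  have minle (u v : R) : Num.min u v <= u /\ Num.min u v <= v.
    by rewrite !ge_min !lexx orbT.
  have [mina minb] := minle (N \1_A) (N \1_(~` A)).
  move=> delta delta0; exists A.
  split; [exact: mA|exact: symA|exact: mina|exact: minb|].
  by apply: le_trans ab _; rewrite lerDl; exact: ltW.
exists (1 / 4); first by lra.
by move=> delta delta0; exact: weakly_norming_split2.
Qed.

Lemma weakly_norming_l1_pairs : atomless nu -> weakly_norming nu H ->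
  forall delta : R, 0 < delta -> exists f g,
  [/\ X f, X g, N f = 1, N g = 1 & 2 - delta <= N (f + g)] /\
  (forall s, 0 <= s -> N (f - s *: g) = N (f + s *: g)).
Proof.
move=> at_nu wn delta delta0; have [c c0 split_c] := weakly_norming_split at_nu wn.
(* The factor [c] compensates the loss [1 / c] caused by normalizing. *)
have [|A [mA symA ca cb ab]] := split_c (delta * c); first exact: mulr_gt0.
have mC : measurable (~` A) by exact: measurableC.
have XA : X \1_A by exact: indic_graph_space.
have XC : X \1_(~` A).
  by apply: (indic_graph_space mC) => x y; exact: congr1 (symA x y).
have a0 := lt_le_trans c0 ca; have b0 := lt_le_trans c0 cb.
have [[_ _ XZ] _ _ _] := wn.
exists ((N \1_A)^-1 *: \1_A), ((N \1_(~` A))^-1 *: \1_(~` A)); split.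
  split.
  - exact: (XZ _ _ XA).
  - exact: (XZ _ _ XC).
  - exact: (norm_normalize wn XA a0).
  - exact: (norm_normalize wn XC b0).
  rewrite -[delta](mulfK (lt0r_neq0 c0)).
  apply: (norm_add_normalized_ge wn XA XC c0 ca cb ab).
    by apply: mulr_ge0; exact: ltW.
  by rewrite -indicT_split; exact: graph_norm1.
by move=> s _; exact: graph_norm_disjoint.
Qed.

End graph_norm_indic.

Theorem theorem1p1 (R : realType) (d : measure_display) (Omega : measurableType d)
    (nu : probability Omega R) (n : nat) (H : sgraph n) :
  standard_borel R Omega -> atomless nu -> weakly_norming nu H ->
  ~ uniformly_smooth (graph_space nu H) (graph_norm nu H) /\
  ~ uniformly_convex (graph_space nu H) (graph_norm nu H).
Proof.
move=> _ at_nu wn; have pairs := weakly_norming_l1_pairs at_nu wn.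
split; first exact: (l1_pairs_not_uniformly_smooth wn).
exact: (l1_pairs_not_uniformly_convex wn).
Qed.
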